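(* There exist real analytic subsets $X\subset\mathbb{R}^n$ and $Y\subset\mathbb{R}^m$ (for some $n,m$), each of pure dimension and containing the origin, such that the germs $(X,0)$ and $(Y,0)$ are bi-Lipschitz homeomorphic, but there is no homeomorphism from $X'_{Nash}$ to $Y'_{Nash}$ sending $\eta_X^{-1}(\mathrm{Sing}(X))$ onto $\eta_Y^{-1}(\mathrm{Sing}(Y))$.
   Context: For a real analytic subset $X\subset\mathbb{R}^n$ of pure dimension $r$, $\mathrm{Sing}(X)$ is the set of singular points of $X$ and $\mathrm{Reg}(X)=X\setminus\mathrm{Sing}(X)$ is the set of regular points (points near which $X$ is an $r$-dimensional analytic submanifold). Let $G_r^n(\mathbb{R})$ be the Grassmannian of $r$-planes in $\mathbb{R}^n$ and define $\nu\colon\mathrm{Reg}(X)\to X\times G_r^n(\mathbb{R})$ by $\nu(x)=(x,T_xX)$, where $T_xX$ is the tangent space of $X$ at $x$. The Nash modification $X'_{Nash}$ is the closure of the image of $\nu$ in $X\times G_r^n(\mathbb{R})$, and the Nash mapping $\eta_X\colon X'_{Nash}\to X$ is induced by the first projection. Two germs $(X,0)$, $(Y,0)$ are bi-Lipschitz homeomorphic if there are neighborhoods of $0$ in $X$ and in $Y$ and a bijection between them, sending $0$ to $0$, which is Lipschitz with Lipschitz inverse for the Euclidean distances. *)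

(* Defs.v *)
From HB Require Import structures.
From mathcomp Require Import all_boot all_order all_algebra.
From mathcomp Require Import all_classical all_reals all_analysis.

Set Implicit Arguments.
Unset Strict Implicit.
Unset Printing Implicit Defensive.

Import Order.TTheory GRing.Theory Num.Theory.
Import numFieldNormedType.Exports.

Local Open Scope classical_set_scope.
Local Open Scope ring_scope.

(* R^n is 'rV[R]_n.  Its library norm is the sup norm: it has the usual
   topology, but metric statements below use [euclid_dist]. *)

Definition euclid_dist (R : realType) (n : nat) (x y : 'rV[R]_n) : R :=
  Num.sqrt (\sum_(i < n) (x 0 i - y 0 i) ^+ 2).

Definition monomial (R : realType) (n : nat)
    (a : {ffun 'I_n -> nat}) (x : 'rV[R]_n) : R :=
  \prod_(i < n) x 0 i ^+ a i.

(* Near p, f is the sum of an absolutely convergent power series in x - p.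
   As the family of terms is summable, its sum may be computed along the
   boxes of multi-indices with all entries < k. *)
Definition analytic_at (R : realType) (n : nat)
    (f : 'rV[R]_n -> R) (p : 'rV[R]_n) : Prop :=
  exists c : {ffun 'I_n -> nat} -> R, \forall x \near p,
    summable [set: {ffun 'I_n -> nat}]
      (fun a => (c a * monomial a (x - p))%:E) /\
    (fun k : nat => \sum_(b : {ffun 'I_n -> 'I_k})
      let a := [ffun i => b i : nat] in c a * monomial a (x - p)) @ \oo --> f x.

Definition analytic_map_on (R : realType) (n m : nat)
    (U : set 'rV[R]_n) (F : 'rV[R]_n -> 'rV[R]_m) : Prop :=
  forall p, U p -> forall j : 'I_m, analytic_at (fun x => F x 0 j) p.

Definition analytic_subset (R : realType) (n : nat) (X : set 'rV[R]_n) : Prop :=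
  forall p : 'rV[R]_n, exists (U : set 'rV[R]_n) (k : nat)
      (F : 'rV[R]_n -> 'rV[R]_k),
    [/\ open U, U p, analytic_map_on U F &
        forall x, U x -> (X x <-> F x = 0)].

(* An analytic diffeomorphism phi : U -> V between open sets, with inverse psi,
   straightens X `&` U to V `&` (R^d x {0}). *)
Definition analytic_manifold_at (R : realType) (n d : nat)
    (X : set 'rV[R]_n) (p : 'rV[R]_n) : Prop :=
  [/\ X p, (d <= n)%N &
    exists (U V : set 'rV[R]_n) (phi psi : 'rV[R]_n -> 'rV[R]_n),
      [/\ open U, U p & open V] /\
      [/\ analytic_map_on U phi, analytic_map_on V psi,
          forall x, U x -> V (phi x) /\ psi (phi x) = x &
          forall y, V y -> U (psi y) /\ phi (psi y) = y] /\
      (forall x, U x ->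
         (X x <-> forall i : 'I_n, (d <= i)%N -> phi x 0 i = 0))].

(* The dimension of X at p is the largest d such that X is a d-dimensional
   analytic manifold near points of X arbitrarily close to p. *)
Definition local_dim (R : realType) (n : nat)
    (X : set 'rV[R]_n) (p : 'rV[R]_n) (d : nat) : Prop :=
  closure [set x | analytic_manifold_at d X x] p /\
  forall e : nat, closure [set x | analytic_manifold_at e X x] p -> (e <= d)%N.

Definition pure_dim (R : realType) (n : nat)
    (X : set 'rV[R]_n) (r : nat) : Prop :=
  forall p, X p -> local_dim X p r.

Definition Reg (R : realType) (n : nat) (r : nat) (X : set 'rV[R]_n) :
    set 'rV[R]_n :=
  [set p | analytic_manifold_at r X p].

Definition Sing (R : realType) (n : nat) (r : nat) (X : set 'rV[R]_n) :
    set 'rV[R]_n :=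
  X `\` Reg r X.

(* Velocities at p of C^1 curves lying in X. *)
Definition tangent_vector (R : realType) (n : nat)
    (X : set 'rV[R]_n) (p v : 'rV[R]_n) : Prop :=
  exists gamma : R -> 'rV[R]_n,
    [/\ gamma 0 = p, derive1 gamma 0 = v &
        \forall t \near (0 : R),
          [/\ X (gamma t), derivable gamma t 1 &
              {for t, continuous (derive1 gamma)}]].

Definition grassmannian (R : realType) (n r : nat) : Type :=
  {V : {vspace 'rV[R]_n} | \dim V == r}.

Section GrassmannianTopology.
Context (R : realType) (n r : nat).

HB.instance Definition _ := Choice.on (grassmannian R n r).

Definition row_span (A : 'M[R]_(r, n)) : {vspace 'rV[R]_n} :=
  <<[seq row i A | i : 'I_r]>>%VS.

Lemma dim_row_span (A : 'M[R]_(r, n)) : row_free A -> \dim (row_span A) == r.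
Proof.
move=> fA; rewrite /row_span.
set s := (X in <<X>>%VS).
have ss : size s = r by rewrite size_image card_ord.
suff : free s by rewrite /free ss.
suff : free (in_tuple s) by [].
apply/freeP => k sk i.
have e : (\row_j k (cast_ord (esym ss) j)) *m A = 0.
  rewrite mulmx_sum_row -[RHS]sk (reindex (cast_ord (esym ss))) /=; last first.
    by exists (cast_ord ss) => j _; rewrite ?cast_ordK ?cast_ordKV.
  apply: eq_bigr => j _; rewrite mxE; congr (_ *: _).
  by rewrite (nth_map j) ?size_enum_ord ?nth_ord_enum //=.
have /rowP/(_ (cast_ord ss i)) : \row_j k (cast_ord (esym ss) j) = 0.
  by apply: (row_free_inj fA); rewrite e mul0mx.
by rewrite !mxE cast_ordK.
Qed.

(* The space of full-rank matrices, with the induced topology. *)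
Definition full_rank_mx : topologicalType :=
  set_type [set A : 'M[R]_(r, n) | row_free A].

Definition plane_of (A : full_rank_mx) : grassmannian R n r :=
  exist (fun V => is_true (\dim V == r)) _ (dim_row_span (set_valP A)).

(* The quotient topology with respect to [plane_of]. *)
Definition grassmannian_open (W : set (grassmannian R n r)) : Prop :=
  open (plane_of @^-1` W).

Fact grassmannian_openT : grassmannian_open setT.
Proof. exact: openT. Qed.

Fact grassmannian_openI : setI_closed grassmannian_open.
Proof. by move=> U V oU oV; exact: openI. Qed.

Fact grassmannian_open_bigU (I : Type) (F : I -> set (grassmannian R n r)) :
  (forall i, grassmannian_open (F i)) -> grassmannian_open (\bigcup_i F i).
Proof.
by move=> oF; apply: bigcup_open => i _; exact: oF.
Qed.

HB.instance Definition _ := isOpenTopological.Build (grassmannian R n r)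
  grassmannian_openT grassmannian_openI grassmannian_open_bigU.

End GrassmannianTopology.

(* nu_graph r X is the image of nu : x |-> (x, T_x X) on Reg r X. *)
Definition nu_graph (R : realType) (n r : nat) (X : set 'rV[R]_n) :
    set ('rV[R]_n * grassmannian R n r)%type :=
  [set z | Reg r X z.1 /\
           forall v : 'rV[R]_n,
             v \in (\val z.2 : {vspace 'rV[R]_n}) <-> tangent_vector X z.1 v].
Arguments nu_graph {R n} r X _.

(* The closure of the image of nu in the subspace X * G_r^n(R). *)
Definition nash (R : realType) (n r : nat) (X : set 'rV[R]_n) :
    set ('rV[R]_n * grassmannian R n r)%type :=
  closure (nu_graph r X) `&` [set z | X z.1].
Arguments nash {R n} r X _.

(* The preimage of S under the Nash mapping nash r X -> X. *)
Definition nash_preimage (R : realType) (n r : nat) (X S : set 'rV[R]_n) :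
    set ('rV[R]_n * grassmannian R n r)%type :=
  nash r X `&` [set z | S z.1].
Arguments nash_preimage {R n} r X S _.

Definition set_homeomorphism (T U : topologicalType) (A : set T) (B : set U)
    (f : T -> U) : Prop :=
  {within A, continuous f} /\
  exists g : U -> T,
    [/\ {within B, continuous g},
        forall x, A x -> B (f x) /\ g (f x) = x &
        forall y, B y -> A (g y) /\ f (g y) = y].

Definition germs_bilipschitz (R : realType) (n m : nat)
    (X : set 'rV[R]_n) (Y : set 'rV[R]_m) : Prop :=
  exists (U : set 'rV[R]_n) (V : set 'rV[R]_m) (h : 'rV[R]_n -> 'rV[R]_m),
    [/\ nbhs (0 : 'rV[R]_n) U, nbhs (0 : 'rV[R]_m) V,
        set_bij (X `&` U) (Y `&` V) h, h 0 = 0 &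
      exists K L : R, forall x y, (X `&` U) x -> (X `&` U) y ->
        euclid_dist (h x) (h y) <= K * euclid_dist x y /\
        euclid_dist x y <= L * euclid_dist (h x) (h y)].

(* Main.v *)
(* X is the line R and Y the curve y^3 = x^4 in R^2, the graph of the
   locally Lipschitz function x^(4/3): projecting Y to the x-axis is a germ of
   bi-Lipschitz homeomorphism onto X.  Now Sing X is empty.  On the other
   hand 0 is a singular point of Y: an analytic immersion s |-> (a s, b s)
   with b^3 = a^4 has b' = 0 at the origin by comparing orders, hence
   b = O(s^2), and then a^4 = O(s^6) contradicts the immersion being
   bi-Lipschitz.  The tangent lines of Y at (t^3, t^4), spanned by (3, 4 t),
   converge as t tends to 0, so some point of Y'_Nash lies over 0, and no map
   sends the empty preimage of Sing X onto the preimage of Sing Y. *)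
Require Import Defs.
From mathcomp Require Import all_boot all_order all_algebra.
From mathcomp Require Import all_classical all_reals all_analysis.
From mathcomp Require Import finmap ring lra.
Set Implicit Arguments.
Unset Strict Implicit.
Unset Printing Implicit Defensive.
Import Order.TTheory GRing.Theory Num.Theory.
Import numFieldNormedType.Exports.
Local Open Scope classical_set_scope.
Local Open Scope ring_scope.

(** * Analytic functions *)

Section PowerSeries.
Variable R : realType.

(** * Absolute summability of families indexed by multi-indices *)

Definition box_index n k (b : {ffun 'I_n -> 'I_k}) : {ffun 'I_n -> nat} :=
  [ffun i => b i : nat].

Lemma box_index_inj n k : injective (@box_index n k).
Proof.
move=> b c /ffunP e; apply/ffunP => i; apply: val_inj.
by have := e i; rewrite !ffunE.
Qed.

Lemma range_box_indexP n k (a : {ffun 'I_n -> nat}) :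
  range (@box_index n k) a <-> forall i, (a i < k)%N.
Proof.
split=> [[b _ <-] i|ak]; first by rewrite ffunE.
by exists [ffun i => Ordinal (ak i)] => //; apply/ffunP => i; rewrite !ffunE.
Qed.

Lemma finite_range_box_index n k : finite_set (range (@box_index n k)).
Proof. by apply: finite_image; exact: finite_finset. Qed.

Lemma sum_range_box_index n k (t : {ffun 'I_n -> nat} -> R) :
  (\sum_(a \in range (@box_index n k)) `|(t a)%:E| =
   (\sum_(b : {ffun 'I_n -> 'I_k}) `|t (box_index b)|)%:E)%E.
Proof.
rewrite fsbig_image; last by move=> ? ? _ _; exact: box_index_inj.
rewrite -sumEFin (fsbigE (index_enum _)) ?index_enum_uniq //.
- by apply: eq_bigl => b; rewrite in_setT.
- by move=> b _; rewrite mem_index_enum.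
Qed.

(** Every finite set of multi-indices lies in a box, of side one more than its largest entry, so
    bounding the box sums bounds all finite sums. This replaces extended-real summability by a real
    bound. *)
Lemma summable_boxP n (t : {ffun 'I_n -> nat} -> R) :
  summable [set: {ffun 'I_n -> nat}] (fun a => (t a)%:E) <->
  exists M : R, forall k,
    \sum_(b : {ffun 'I_n -> 'I_k}) `|t (box_index b)| <= M.
Proof.
split.
  rewrite summableE; set S := esum _ _ => Sfin.
  exists (fine S) => k; rewrite -lee_fin fineK // -sum_range_box_index.
  by apply: ereal_sup_ubound; exists (range (@box_index n k)) => //;
    split => //; exact: finite_range_box_index.
move=> [M hM]; apply: (@le_lt_trans _ _ M%:E); last exact: ltry.
apply: ge_ereal_sup => _ [A [finA _] <-].
pose k := (\max_(a <- fset_set A) \max_i a i).+1.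
apply: (@le_trans _ _ (\sum_(a \in range (@box_index n k)) `|(t a)%:E|)%E).
  apply: lee_fsum_nneg_subset => //; first exact: finite_range_box_index.
  move=> a /set_mem aA; apply/mem_set/range_box_indexP => i.
  rewrite ltnS; apply: (@leq_trans (\max_j a j)%N).
      exact: (@leq_bigmax_cond _ xpredT (fun j => a j)).
    by rewrite (big_rem a) ?leq_maxl // in_fset_set //; exact/mem_set.
by rewrite sum_range_box_index lee_fin.
Qed.


(** * Power series in one variable and products of one-variable functions *)

(** One-variable form of the condition in [analytic_at]: absolute convergence is recorded as a
    uniform bound on partial sums. *)
Definition pseries_sum (u : nat -> R) (h l : R) : Prop :=
  (exists M : R, forall k, \sum_(i < k) `|u i * h ^+ i| <= M) /\
  (fun k : nat => \sum_(i < k) u i * h ^+ i) @ \oo --> l.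

Definition analytic1_at (g : R -> R) (p : R) : Prop :=
  exists u : nat -> R, \forall x \near p, pseries_sum u (x - p) (g x).

(** By distributivity, a box sum of products is the product of the one-variable partial sums. The
    same identity with absolute values gives summability. *)
Lemma analytic_at_prod n (g : 'I_n -> R -> R) (p : 'rV[R]_n) :
  (forall i, analytic1_at (g i) (p 0 i)) ->
  analytic_at (fun x => \prod_(i < n) g i (x 0 i)) p.
Proof.
move=> gp.
have /choice[u hu] := gp.
exists (fun a => \prod_(i < n) u i (a i)).
have : \forall x \near p, forall i : 'I_n,
    pseries_sum (u i) ((x : 'rV[R]_n) 0 i - p 0 i) (g i (x 0 i)).
  apply: (@filter_forall _ _
    (fun i (x : 'rV[R]_n) => pseries_sum (u i) (x 0 i - p 0 i) (g i (x 0 i)))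
    (nbhs p) _) => i.
  exact: (@coord_continuous R 1 n 0 i p _ (hu i)).
apply: filterS => x hx.
have termE k (b : {ffun 'I_n -> 'I_k}) :
    (\prod_(i < n) u i (box_index b i)) * monomial (box_index b) (x - p) =
    \prod_(i < n) (u i (b i) * (x 0 i - p 0 i) ^+ b i).
  rewrite /monomial -big_split /=; apply: eq_bigr => i _.
  by rewrite ffunE !mxE.
split; last first.
  have -> : (fun k : nat => \sum_(b : {ffun 'I_n -> 'I_k})
      let a := [ffun i => b i : nat] in
      (\prod_(i < n) u i (a i)) * monomial a (x - p)) =
    (fun k : nat => \prod_(i < n) \sum_(j < k) u i j * (x 0 i - p 0 i) ^+ j).
    apply/funext => k; rewrite bigA_distr_bigA /=.
    by apply: eq_bigr => b _; exact: termE.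
  apply: (@cvg_big R^o 'I_n *%R 1 xpredT) => [|i _]; last exact: (hx i).2.
  exact: mul_continuous.
apply/summable_boxP.
have /choice[M hM] := fun i => (hx i).1.
exists (\prod_(i < n) M i) => k.
under eq_bigr do rewrite termE normr_prod.
rewrite -(bigA_distr_bigA (fun i (j : 'I_k) => `|u i j * (x 0 i - p 0 i) ^+ j|)).
by apply: ler_prod => i _; rewrite hM andbT sumr_ge0.
Qed.

Lemma analytic_atD n (f g : 'rV[R]_n -> R) p :
  analytic_at f p -> analytic_at g p -> analytic_at (fun x => f x + g x) p.
Proof.
move=> [c hc] [d hd]; exists (fun a => c a + d a).
apply: filterS2 hc hd => x [sc fc] [sd gd]; split.
  have := summableD sc sd; congr summable; apply/funext => a /=.
  by rewrite mulrDl EFinD.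
under eq_cvg do (under eq_bigr do rewrite mulrDl; rewrite big_split /=).
exact: cvgD.
Qed.

Lemma analytic_atN n (f : 'rV[R]_n -> R) p :
  analytic_at f p -> analytic_at (fun x => - f x) p.
Proof.
move=> [c hc]; exists (fun a => - c a).
apply: filterS hc => x [sc fc]; split.
  move: sc; rewrite summableN; congr summable; apply/funext => a /=.
  by rewrite mulNr EFinN.
under eq_cvg do (under eq_bigr do rewrite mulNr; rewrite sumrN).
exact: cvgN.
Qed.


(** * Expansions of powers and of inverse powers *)

(** The coefficients are those of the binomial expansion of [(p + (x - p)) ^+ k]; they vanish beyond
    [k], so the partial sums are eventually constant. *)
Lemma analytic1_exp k (p : R) : analytic1_at (fun x => x ^+ k) p.
Proof.
pose u i := p ^+ (k - i) *+ 'C(k, i).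
have u0 i : (k < i)%N -> u i = 0 by move=> ki; rewrite /u bin_small // mulr0n.
have cut (F : nat -> R) m : (forall i, (k < i)%N -> F i = 0) -> (k < m)%N ->
    \sum_(i < m) F i = \sum_(i < k.+1) F i.
  move=> F0 km; rewrite -!(big_mkord xpredT) (big_cat_nat _ (n := k.+1)) //=.
  by rewrite [X in _ + X]big_nat_cond [X in _ + X]big1 ?addr0 // => i /andP[/andP[/F0]].
exists u; near=> x; split.
  exists (\sum_(i < k.+1) `|u i * (x - p) ^+ i|) => m.
  apply: (@le_trans _ _ (\sum_(i < maxn m k.+1) `|u i * (x - p) ^+ i|)).
    by rewrite -!(big_mkord xpredT (fun i => `|u i * (x - p) ^+ i|))
      [leRHS](big_cat_nat _ (n := m)) ?leq_maxl //= lerDl sumr_ge0.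
  rewrite (cut (fun i => `|u i * (x - p) ^+ i|)) ?leq_max ?leqnn ?orbT //.
  by move=> i /u0 ->; rewrite mul0r normr0.
have xE : x ^+ k = \sum_(i < k.+1) u i * (x - p) ^+ i.
  rewrite -[in LHS](subrKC p x) exprDn; apply: eq_bigr => i _.
  by rewrite /u mulrnAl.
rewrite xE; apply: cvg_near_cst; exists k.+1 => // m /= km.
by rewrite (cut (fun i => u i * (x - p) ^+ i)) // => i /u0 ->; rewrite mul0r.
Unshelve. all: by end_near. Qed.

(** Induction on [k]: by Pascal's rule, multiplying a partial sum of order [k.+1] by [1 - z] gives
    the partial sum of order [k] minus a boundary term, and this term tends to 0. *)
Lemma cvg_negative_binomial k (z : R) :
  `|z| < 1 ->
  (fun n : nat => \sum_(i < n) 'C(i + k, k)%:R * z ^+ i) @ \oo -->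
    (1 - z) ^- k.+1.
Proof.
elim: k z => [|k IHk] z z1.
  rewrite expr1 -[X in _ --> X]mul1r; have := cvg_geometric_series (a := 1) z1.
  apply: cvg_trans; apply: near_eq_cvg; near=> n.
  rewrite /series /= big_mkord; apply: eq_bigr => i _.
  by rewrite /geometric /= bin0 !mul1r.
have rec (y : R) n : (1 - y) * \sum_(i < n) 'C(i + k.+1, k.+1)%:R * y ^+ i =
    \sum_(i < n) 'C(i + k, k)%:R * y ^+ i - 'C(n + k, k.+1)%:R * y ^+ n.
  elim: n => [|n IHn].
    by rewrite !big_ord0 mulr0 add0n bin_small // mul0r subr0.
  rewrite !big_ord_recr /= mulrDr IHn addnS addSn binS natrD exprS; ring.
have r0 : 0 <= `|z| := normr_ge0 z.
have r1 : 0 < 1 - `|z| by rewrite subr_gt0.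
have nz : 1 - z != 0.
  by rewrite subr_eq0 eq_sym; apply: contraTneq z1 => ->; rewrite normr1 ltxx.
(* At [|z|] the partial sums increase, and [rec] bounds them by the convergent ones of order [k]
   divided by [1 - |z|]. *)
have cr : cvgn (series (fun i => 'C(i + k.+1, k.+1)%:R * `|z| ^+ i)).
  have nz1 : `| `|z| | < 1 by rewrite normr_id.
  have [M [_ /= Mb]] := cvg_seq_bounded (cvgP _ (IHk _ nz1)).
  apply: nondecreasing_is_cvgn.
    move=> m n mn; rewrite /series /= [leRHS](big_cat_nat _ (n := m)) //= lerDl.
    by apply: sumr_ge0 => i _; rewrite mulr_ge0 ?ler0n ?exprn_ge0.
  exists ((M + 1) / (1 - `|z|)) => _ [n _ <-]; rewrite ler_pdivlMr // mulrC.
  rewrite /series /= big_mkord rec.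
  have := Mb (M + 1); rewrite ltrDl ltr01 => /(_ isT n I) /=.
  apply: le_trans; rewrite (le_trans _ (ler_norm _)) // gerDl oppr_le0.
  by rewrite mulr_ge0 ?ler0n ?exprn_ge0.
(* The boundary term is dominated by the general term of the convergent series [cr], since
   ['C(n + k, k.+1) <= 'C(n + k.+1, k.+1)]. *)
have t0 : (fun n : nat => 'C(n + k, k.+1)%:R * z ^+ n) @ \oo --> (0 : R).
  apply/norm_cvg0P; have := cvg_series_cvg_0 cr.
  apply: squeeze_cvgr; last exact: cvg_cst.
  near=> n; rewrite normr_ge0 normrM normrX normr_nat /=.
  by rewrite ler_wpM2r ?exprn_ge0 // ler_nat addnS binS leq_addr.
have -> : (fun n : nat => \sum_(i < n) 'C(i + k.+1, k.+1)%:R * z ^+ i) =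
   (fun n => (\sum_(i < n) 'C(i + k, k)%:R * z ^+ i - 'C(n + k, k.+1)%:R * z ^+ n)
       / (1 - z)).
  by apply/funext => n; rewrite -rec mulrAC mulfV // mul1r.
rewrite exprSr invfM -[X in X * _]subr0.
by apply: cvgMr_tmp; apply: cvgB => //; exact: IHk.
Unshelve. all: by end_near. Qed.

(** Write [x = p * (1 - z)] with [z = - ((x - p) / p)] and apply the negative binomial series, valid
    for [|z| < 1]. *)
Lemma analytic1_exprV k (p : R) : p != 0 -> analytic1_at (fun x => x ^- k.+1) p.
Proof.
move=> p0; exists (fun i => 'C(i + k, k)%:R * (- p^-1) ^+ i * p ^- k.+1).
have : \forall x \near p, `|(x - p) / p| < 1.
  near=> x; rewrite normrM normfV ltr_pdivrMr ?normr_gt0 // mul1r distrC.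
  by near: x; apply: cvgr_dist_lt; rewrite ?normr_gt0.
apply: filterS => x xp.
have z1 : `|- ((x - p) / p)| < 1 by rewrite normrN.
have xE : x = p * (1 - - ((x - p) / p)) by field.
have tE i : 'C(i + k, k)%:R * (- p^-1) ^+ i * p ^- k.+1 * (x - p) ^+ i =
    'C(i + k, k)%:R * (- ((x - p) / p)) ^+ i * p ^- k.+1.
  rewrite [_ / p]mulrC -mulNr exprMn.
  by rewrite [in LHS]mulrAC [in RHS]mulrA.
split; last first.
  under eq_cvg do (under eq_bigr do rewrite tE; rewrite -mulr_suml).
  have -> : x ^- k.+1 = (1 - - ((x - p) / p)) ^- k.+1 * p ^- k.+1.
    by rewrite {1}xE exprMn invfM mulrC.
  apply: cvgMr_tmp.
  exact: cvg_negative_binomial.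
have nz1 : `| `|(x - p) / p| | < 1 by rewrite normr_id.
have [M [_ /= Mb]] := cvg_seq_bounded (cvgP _ (cvg_negative_binomial (k := k) nz1)).
exists ((M + 1) * `|p ^- k.+1|) => m.
under eq_bigr do rewrite tE normrM.
rewrite -mulr_suml ler_wpM2r //.
have := Mb (M + 1); rewrite ltrDl ltr01 => /(_ isT m I) /=.
apply: le_trans; rewrite (le_trans _ (ler_norm _)) //.
by apply: ler_sum => i _; rewrite normrM normrX normrN normr_nat.
Unshelve. all: by end_near. Qed.


(** * Coefficient bounds and Taylor estimates *)

Lemma ler_coord_norm n (x : 'rV[R]_n) i : `|x 0 i| <= `|x|.
Proof.
rewrite [leRHS]/Num.Def.normr /= mx_normrE.
exact: (le_bigmax _ (fun ij : 'I_1 * 'I_n => `|x ij.1 ij.2|) (0, i)).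
Qed.

Lemma monomial_const n (a : {ffun 'I_n -> nat}) (r : R) :
  monomial a (const_mx r) = r ^+ (\sum_i a i).
Proof. by rewrite -prodrXr; apply: eq_bigr => i _; rewrite mxE. Qed.

Lemma ler_norm_monomial n (a : {ffun 'I_n -> nat}) (h : 'rV[R]_n) (r : R) :
  0 < r ->
  `|monomial a h| <= (`|h| / r) ^+ (\sum_i a i) * r ^+ (\sum_i a i).
Proof.
move=> r0; rewrite -exprMn divfK ?gt_eqF // -monomial_const normr_prod.
apply: ler_prod => i _; rewrite normr_ge0 normrX mxE /=.
by rewrite lerXn2r ?nnegrE ?ler_coord_norm.
Qed.

(** Absolute convergence at the point of the neighbourhood whose displacement from [p] has all
    coordinates [e / 2] bounds the coefficients, because a monomial there depends only on its
    degree. *)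
Lemma analytic_at_majorant n (f : 'rV[R]_n -> R) p : analytic_at f p ->
  exists (c : {ffun 'I_n -> nat} -> R) (r M : R), [/\ 0 < r,
    forall k, \sum_(b : {ffun 'I_n -> 'I_k})
      `|c (box_index b)| * r ^+ (\sum_i box_index b i) <= M &
    forall x, `|x - p| < r -> (fun k : nat => \sum_(b : {ffun 'I_n -> 'I_k})
        c (box_index b) * monomial (box_index b) (x - p)) @ \oo --> f x].
Proof.
move=> [c /nbhs_ballP[e /= e0 ec]].
have e20 : 0 < e / 2 by rewrite divr_gt0.
have [] := ec (p + const_mx (e / 2)).
  rewrite -ball_normE /= opprD addNKr normrN.
  apply: (@le_lt_trans _ _ (e / 2)); last by rewrite ltr_pdivrMr // ltr_pMr // ltr1n.
  rewrite [leLHS]/Num.Def.normr /= mx_normrE bigmax_le ?(ltW e20) // => i _.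
  by rewrite mxE gtr0_norm.
rewrite [p + _ - p]addrC addKr => /summable_boxP[M hM] _.
exists c, (e / 2), M; split => // [k|x xp].
  apply: le_trans (hM k); apply: ler_sum => b _.
  by rewrite normrM monomial_const normrX (gtr0_norm e20).
apply: (ec x _).2; rewrite -ball_normE /= distrC.
by apply: lt_trans xp _; rewrite ltr_pdivrMr // ltr_pMr // ltr1n.
Qed.

(** General Taylor remainder: [S] selects the retained terms, [s] is their eventual sum, and each
    remaining monomial is at most [lam] times its value at radius [r], so the tail costs at most
    [lam * M]. *)
Lemma box_sum_remainder n (c : {ffun 'I_n -> nat} -> R) (r M l s lam : R)
    (h : 'rV[R]_n) (S : {pred {ffun 'I_n -> nat}}) :
  (forall k, \sum_(b : {ffun 'I_n -> 'I_k})
      `|c (box_index b)| * r ^+ (\sum_i box_index b i) <= M) ->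
  (fun k : nat => \sum_(b : {ffun 'I_n -> 'I_k})
      c (box_index b) * monomial (box_index b) h) @ \oo --> l ->
  0 < r -> 0 <= lam ->
  (forall a, a \notin S -> `|monomial a h| <= lam * r ^+ (\sum_i a i)) ->
  (\forall k \near \oo, \sum_(b : {ffun 'I_n -> 'I_k} | box_index b \in S)
      c (box_index b) * monomial (box_index b) h = s) ->
  `|l - s| <= lam * M.
Proof.
move=> hM hl r0 lam0 hS hs.
have cvl : (fun k : nat => `|\sum_(b : {ffun 'I_n -> 'I_k})
    c (box_index b) * monomial (box_index b) h - s|) @ \oo --> `|l - s|.
  by apply: cvg_norm; apply: cvgB hl _; exact: cvg_cst.
apply: (cvgr_to_le cvl).
near=> k; rewrite /= (bigID [pred b | box_index b \in S]) /=.
rewrite (_ : \sum_(b | box_index b \in S) _ = s); last by near: k.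
rewrite [s + _]addrC addrK (le_trans (ler_norm_sum _ _ _)) //.
rewrite (le_trans _ (ler_wpM2l lam0 (hM k))) // mulr_sumr.
rewrite [leRHS](bigID [pred b | box_index b \in S]) /=.
rewrite -[leLHS]add0r lerD ?sumr_ge0 // => [b _|].
  by rewrite !mulr_ge0 ?exprn_ge0 ?(ltW r0).
apply: ler_sum => b bS; rewrite normrM mulrCA ler_wpM2l //.
exact: hS.
Unshelve. all: by end_near. Qed.

Lemma eq_box_index n k (a : {ffun 'I_n -> nat}) (b b' : {ffun 'I_n -> 'I_k}) :
  box_index b' = a -> (box_index b == a) = (b == b').
Proof. by move=> <-; rewrite (inj_eq (@box_index_inj _ _)). Qed.

Lemma big_box_pred1 n k (a : {ffun 'I_n -> nat}) (F : {ffun 'I_n -> nat} -> R) :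
  (forall i, a i < k)%N ->
  \sum_(b : {ffun 'I_n -> 'I_k} | box_index b == a) F (box_index b) = F a.
Proof.
move=> /range_box_indexP[b' _ b'a].
by rewrite (big_pred1 b') ?b'a // => b; exact: eq_box_index.
Qed.

(** Only the constant term is retained; every other monomial has positive degree, which yields one
    factor [|x - p| / r]. *)
Lemma analytic_at_locally_lipschitz n (f : 'rV[R]_n -> R) p : analytic_at f p ->
  exists C : R, \forall x \near p, `|f x - f p| <= C * `|x - p|.
Proof.
move=> /analytic_at_majorant[c [r [M [r0 hM hf]]]].
pose z : {ffun 'I_n -> nat} := [ffun=> 0%N].
have near0 (x : 'rV[R]_n) : `|x - p| < r -> `|f x - c z| <= `|x - p| / r * M.
  move=> xp; apply: (box_sum_remainder (S := pred1 z) hM (hf _ xp)) => //.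
  - by rewrite divr_ge0 ?(ltW r0).
  - move=> a /eqP az; apply: (le_trans (ler_norm_monomial _ _ r0)).
    rewrite ler_wpM2r ?exprn_ge0 ?(ltW r0) //.
    have h1 : `|x - p| / r <= 1 by rewrite ler_pdivrMr // mul1r ltW.
    have h0 : 0 <= `|x - p| / r by rewrite divr_ge0 ?(ltW r0).
    have : (0 < \sum_i a i)%N.
      rewrite lt0n; apply: contra_notN az; rewrite sum_nat_eq0 => /forallP a0.
      by apply/ffunP => i; rewrite ffunE; apply/eqP; exact: a0.
    case: (\sum_i a i)%N => // m _; rewrite exprS ler_piMr //.
    by rewrite exprn_ile1.
  - exists 1%N => // k /= k1; rewrite (@big_box_pred1 _ _ z (fun a => c a * monomial a (x - p))); last first.
      by move=> i; rewrite ffunE.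
    by rewrite /monomial big1 ?mulr1 // => i _; rewrite ffunE.
(* The estimate at [x = p] identifies the constant coefficient. *)
have fp : f p = c z.
  apply/eqP; rewrite -subr_eq0 -normr_le0 (le_trans (near0 p _)) ?subrr ?normr0 //.
  by rewrite mul0r mul0r.
exists (M / r); near=> x; rewrite fp mulrAC [_ * `|x - p|]mulrC mulrAC; apply: near0.
by rewrite distrC; near: x; exact: cvgr_dist_lt.
Unshelve. all: by end_near. Qed.

(** The constant term and the term linear in coordinate [i] are retained; along the line the other
    monomials vanish or have degree at least 2. *)
Lemma analytic_at_line_taylor2 n (f : 'rV[R]_n -> R) p i : analytic_at f p ->
  exists beta C : R, \forall s \near (0 : R),
    `|f (p + s *: delta_mx 0 i) - f p - beta * s| <= C * s ^+ 2.
Proof.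
move=> /analytic_at_majorant[c [r [M [r0 hM hf]]]].
pose z : {ffun 'I_n -> nat} := [ffun=> 0%N].
pose e : {ffun 'I_n -> nat} := [ffun j => (j == i) : nat].
have ez : e != z.
  by apply/eqP => /ffunP/(_ i); rewrite !ffunE eqxx.
have near0 (s : R) : `|s| < r ->
    `|f (p + s *: delta_mx 0 i) - (c z + c e * s)| <= (`|s| / r) ^+ 2 * M.
  move=> sr; set h := s *: delta_mx 0 i.
  have h0 j : h 0 j = s *+ (j == i).
    by rewrite !mxE eqxx /= mulr_natr.
  have hs : `|h| = `|s|.
    apply/eqP; rewrite eq_le; apply/andP; split; last first.
      by rewrite (le_trans _ (ler_coord_norm h i)) // h0 eqxx mulr1n.
    rewrite [leLHS]/Num.Def.normr /= mx_normrE bigmax_le // => -[k j] _.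
    by rewrite /= ord1 h0; case: (j == i); rewrite ?mulr1n // mulr0n normr0.
  have hr : `|p + h - p| < r by rewrite [p + _]addrC addrK hs.
  have := hf _ hr; rewrite [p + h - p]addrC addKr => hcv.
  apply: (box_sum_remainder (S := pred2 z e) hM hcv) => //.
  - by rewrite exprn_ge0 // divr_ge0 ?(ltW r0).
  - move=> a; rewrite !inE negb_or => /andP[/eqP az /eqP ae].
    (* If [a] involves a coordinate other than [i], its monomial is zero on the line; otherwise
       excluding [z] and [e] forces [a i] to be at least 2. *)
    have [/existsP[j /andP[ji aj]]|] := boolP [exists j, (j != i) && (0 < a j)%N].
      rewrite /monomial (bigD1 j) //= h0 (negbTE ji) mulr0n expr0n -[a j == _]negbK -lt0n aj.
      by rewrite mul0r normr0 mulr_ge0 ?exprn_ge0 ?divr_ge0 ?(ltW r0).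
    rewrite negb_exists => /forallP aj.
    have {}aj j : j != i -> a j = 0%N.
      by move=> ji; apply/eqP; rewrite -leqn0 leqNgt; have := aj j; rewrite ji.
    have ai : (1 < a i)%N.
      case E : (a i) => [|[|m]] //; exfalso.
        by apply: az; apply/ffunP => j; rewrite ffunE; have [->|/aj->] := eqVneq j i.
      by apply: ae; apply/ffunP => j; rewrite ffunE; have [->|/aj->] := eqVneq j i.
    apply: (le_trans (ler_norm_monomial _ _ r0)); rewrite hs.
    rewrite ler_wpM2r ?exprn_ge0 ?(ltW r0) //.
    apply: ler_wiXn2l; first by rewrite divr_ge0 ?(ltW r0).
      by rewrite ler_pdivrMr // mul1r ltW.
    by rewrite (leq_trans ai) // (bigD1 i) //= leq_addr.
  (* Side 2 is the least for which the box contains [e]. *)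
  - exists 2%N => // k /= k2.
    pose F a := c a * monomial a h.
    rewrite (bigID [pred b | box_index b == z]) /=.
    rewrite (eq_bigl [pred b | box_index b == z]); last first.
      by move=> b /=; rewrite inE; case: (_ == z); rewrite ?andbF.
    rewrite [X in _ + X](eq_bigl [pred b | box_index b == e]); last first.
      move=> b /=; rewrite inE; have [->|_] := eqVneq (box_index b) z.
        by rewrite /= eq_sym (negbTE ez).
      by rewrite /= andbT.
    rewrite (@big_box_pred1 _ _ z F) ?(@big_box_pred1 _ _ e F) => [|j|j]; last 2 first.
    + by rewrite ffunE (leq_ltn_trans (leq_b1 _)).
    + by rewrite ffunE (leq_trans _ k2).
    congr (_ + _); first by rewrite /F /monomial big1 ?mulr1 // => j _; rewrite ffunE.
    rewrite /F /monomial (bigD1 i) //= big1 ?mulr1; first by rewrite ffunE h0 eqxx.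
    by move=> j ji; rewrite ffunE (negbTE ji).
have fp : f p = c z.
  have := near0 0; rewrite normr0 scale0r addr0 mul0r expr0n /= mul0r mulr0 addr0.
  by move=> /(_ r0); rewrite normr_le0 subr_eq0 => /eqP.
exists (c e), (M / r ^+ 2); near=> s.
rewrite fp -addrA -opprD; apply: le_trans (near0 s _) _.
  by near: s; exact: (@nbhs0_lt _ R^o _ r0).
rewrite expr_div_n real_normK ?num_real //.
by rewrite [leRHS]mulrC [leRHS]mulrCA [leRHS]mulrC.
Unshelve. all: by end_near. Qed.

End PowerSeries.

(** * The curve y^3 = x^4 *)

Section CuspCurve.
Variable R : realType.

(** * Coordinates and analytic functions on the plane *)

Definition pt2 (a b : R) : 'rV[R]_2 := \row_(j < 2) (if j == 0 then a else b).

Lemma pt2E0 a b : pt2 a b 0 0 = a. Proof. by rewrite mxE. Qed.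

Lemma pt2E1 a b : pt2 a b 0 1 = b. Proof. by rewrite mxE. Qed.

Lemma ord2_neq0 (j : 'I_2) : j != 0 -> j = 1.
Proof. by move=> j0; apply/val_inj; case: j j0 => -[|[]]. Qed.

Lemma ord2_gt0 (j : 'I_2) : (0 < j)%N -> j = 1.
Proof. by move=> j0; apply/val_inj; case: j j0 => -[|[]]. Qed.

Lemma eq_rV2 (x y : 'rV[R]_2) : x 0 0 = y 0 0 -> x 0 1 = y 0 1 -> x = y.
Proof.
move=> e0 e1; apply/rowP => j.
by have [->//|/ord2_neq0->] := eqVneq j 0.
Qed.

Definition cusp : set 'rV[R]_2 := [set x | x 0 1 ^+ 3 = x 0 0 ^+ 4].

Lemma cusp0 : cusp 0.
Proof. by rewrite /cusp /= !mxE !expr0n. Qed.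

Lemma cusp_pt2 t : cusp (pt2 (t ^+ 3) (t ^+ 4)).
Proof. by rewrite /cusp /= pt2E0 pt2E1 -!exprM. Qed.

Lemma analytic_at_mul2 (g0 g1 : R -> R) (p : 'rV[R]_2) :
  analytic1_at g0 (p 0 0) -> analytic1_at g1 (p 0 1) ->
  analytic_at (fun x => g0 (x 0 0) * g1 (x 0 1)) p.
Proof.
move=> a0 a1; pose g (i : 'I_2) := if i == 0 then g0 else g1.
have -> : (fun x : 'rV[R]_2 => g0 (x 0 0) * g1 (x 0 1)) =
    (fun x => \prod_(i < 2) g i (x 0 i)).
  apply/funext => x; rewrite !big_ord_recl big_ord0 mulr1 /g /=.
  by rewrite (_ : lift 0 0 = 1) //; apply/val_inj.
by apply: analytic_at_prod => i; rewrite /g; have [->|/ord2_neq0->] := eqVneq i 0.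
Qed.

Lemma analytic_at_monom2 i j (p : 'rV[R]_2) :
  analytic_at (fun x => x 0 0 ^+ i * x 0 1 ^+ j) p.
Proof.
apply: (@analytic_at_mul2 (fun x => x ^+ i) (fun x => x ^+ j));
  exact: analytic1_exp.
Qed.

Lemma analytic_at_monomV2 i j (p : 'rV[R]_2) : p 0 0 != 0 ->
  analytic_at (fun x => x 0 0 ^- i.+1 * x 0 1 ^+ j) p.
Proof.
move=> p0; apply: (@analytic_at_mul2 (fun x => x ^- i.+1) (fun x => x ^+ j)).
  exact: analytic1_exprV.
exact: analytic1_exp.
Qed.

Lemma analytic_map_on_pt2 (U : set 'rV[R]_2) (f g : 'rV[R]_2 -> R) :
  (forall p, U p -> analytic_at f p) -> (forall p, U p -> analytic_at g p) ->
  analytic_map_on U (fun x => pt2 (f x) (g x)).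
Proof.
move=> hf hg p Up j; have [->|/ord2_neq0->] := eqVneq j 0.
  by under eq_fun do rewrite pt2E0; exact: hf.
by under eq_fun do rewrite pt2E1; exact: hg.
Qed.

Lemma open_neq0 (T : topologicalType) (f : T -> R) :
  continuous f -> open [set x | f x != 0].
Proof.
move=> cf; rewrite openE => x /= fx0; rewrite /interior.
exact: (cvgr_neq0 _ (cf x)).
Qed.

(** * The curve as an analytic set and its regular points *)

Lemma analytic_subset_cusp : analytic_subset cusp.
Proof.
move=> p; exists setT, 1%N, (fun x => const_mx (x 0 1 ^+ 3 - x 0 0 ^+ 4)).
split=> //; first exact: openT.
  move=> q _ j; under eq_fun do rewrite mxE.
  apply: analytic_atD.
    by have := @analytic_at_monom2 0 3 q; under eq_fun do rewrite mul1r.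
  apply: analytic_atN.
  by have := @analytic_at_monom2 4 0 q; under eq_fun do rewrite mulr1.
move=> x _; rewrite /cusp /=; split=> [->|/rowP/(_ 0)].
  by apply/rowP => j; rewrite !mxE subrr.
by rewrite !mxE => /eqP; rewrite subr_eq0 => /eqP.
Qed.

(* Off the origin the parameter t = y / x of the curve is analytic, and the
   chart (t, x - t^3) has the polynomial inverse
   (t, v) |-> (v + t^3, t (v + t^3)). *)
Lemma cusp_regular_neq0 p :
  cusp p -> p 0 0 != 0 -> analytic_manifold_at 1 cusp p.
Proof.
move=> Yp p0; split=> //.
pose phi (x : 'rV[R]_2) :=
  pt2 (x 0 1 / x 0 0) (x 0 0 - x 0 1 ^+ 3 / x 0 0 ^+ 3).
pose psi (u : 'rV[R]_2) :=
  pt2 (u 0 1 + u 0 0 ^+ 3) (u 0 0 * u 0 1 + u 0 0 ^+ 4).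
exists [set x | x 0 0 != 0], [set u | u 0 1 + u 0 0 ^+ 3 != 0], phi, psi.
have cc i : continuous (fun x : 'rV[R]_2 => x 0 i) by exact: coord_continuous.
split; [split=> //|split; [split|]].
- exact: open_neq0.
- apply: open_neq0 => x; apply: (cvgD (cc 1 x)).
  apply: (@continuous_comp _ _ _ (fun x : 'rV[R]_2 => x 0 0) (fun r : R => r ^+ 3)).
    exact: cc.
  exact: exprn_continuous.
- apply: analytic_map_on_pt2 => q /= q0.
    (* The exponent of the inverse is shifted by one: index 0 stands for [1 / x], and index 2 below
       for [1 / x ^+ 3]. *)
    have := @analytic_at_monomV2 0 1 q q0.
    by under eq_fun do rewrite expr1 mulrC.
  apply: analytic_atD; first by have := @analytic_at_monom2 1 0 q; under eq_fun do rewrite mulr1.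
  apply: analytic_atN; have := @analytic_at_monomV2 2 3 q q0.
  by under eq_fun do rewrite mulrC.
- apply: analytic_map_on_pt2 => q _.
    apply: analytic_atD.
      by have := @analytic_at_monom2 0 1 q; under eq_fun do rewrite mul1r.
    by have := @analytic_at_monom2 3 0 q; under eq_fun do rewrite mulr1.
  apply: analytic_atD; first exact: (@analytic_at_monom2 1 1 q).
  by have := @analytic_at_monom2 4 0 q; under eq_fun do rewrite mulr1.
- move=> x /= x0; rewrite /psi !pt2E0 !pt2E1.
  have e : x 0 0 - x 0 1 ^+ 3 / x 0 0 ^+ 3 + (x 0 1 / x 0 0) ^+ 3 = x 0 0 by field.
  by rewrite e; split => //; apply: eq_rV2; rewrite ?pt2E0 ?pt2E1 //; field.
- move=> u /= u0; rewrite /phi !pt2E0 !pt2E1; split => //.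
  by apply: eq_rV2; rewrite ?pt2E0 ?pt2E1 //; field.
- move=> x /= x0; rewrite /cusp /=; split=> [e i i1|/(_ 1 isT)].
  + by rewrite (ord2_gt0 i1) pt2E1 e; field.
  + rewrite pt2E1 => /eqP; rewrite subr_eq0 => /eqP e.
    by rewrite [RHS]exprS {1}e divfK // expf_neq0.
Qed.


(* With [A = |a s| / s] and [B = |b s| / s], the equation gives
   [B ^ 3 = s * A ^ 4], so [B] tends to [0] and [beta = 0]; then [B = O(s)],
   whence [A ^ 4 = O(s ^ 2)] and [A + B] tends to [0]. *)
Lemma cusp_no_immersion (a b : R -> R) (beta C : R) :
  0 < C ->
  (\forall s \near 0^'+, [/\ b s ^+ 3 = a s ^+ 4, `|a s| <= C * s,
    `|b s - beta * s| <= C * s ^+ 2 & s <= C * (`|a s| + `|b s|)]) ->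
  False.
Proof.
move=> C0 hab.
have {}hab : \forall s \near 0^'+, exists A B : R,
   [/\ 0 <= A <= C, 0 <= B, B ^+ 3 = s * A ^+ 4, `|B - `|beta| | <= C * s
       & 1 <= C * (A + B)].
  near=> s.
  have s0 : 0 < s by near: s; exact: nbhs_right_gt.
  have [e ha hb hs] : [/\ b s ^+ 3 = a s ^+ 4, `|a s| <= C * s,
    `|b s - beta * s| <= C * s ^+ 2 & s <= C * (`|a s| + `|b s|)] by near: s.
  exists (`|a s| / s), (`|b s| / s); split.
  - by rewrite divr_ge0 ?(ltW s0) //= ler_pdivrMr.
  - by rewrite divr_ge0 ?(ltW s0).
  - rewrite !expr_div_n -!normrX e normrX; field; exact: lt0r_neq0.
  - have -> : `|b s| / s - `|beta| = (`|b s| - `|beta * s|) / s.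
      by rewrite normrM (gtr0_norm s0); field; exact: lt0r_neq0.
    rewrite normrM normfV (gtr0_norm s0) ler_pdivrMr // -mulrA -expr2.
    exact: le_trans (ler_dist_dist _ _) _.
  - by rewrite -mulrDl mulrA ler_pdivlMr // mul1r.
have b0 : beta = 0.
  apply/eqP; apply: contraT => beta0.
  have nb : 0 < `|beta| by rewrite normr_gt0.
  (* The first upper bound on [s] gives [B >= |beta| / 2]; the second gives
     [s * A ^+ 4 < (|beta| / 2) ^+ 3], contradicting the equation. *)
  have [s [s0 s1 s2 [A [B [/andP[A0 AC] B0 e hb _]]]]] : exists s,
      [/\ 0 < s, s < `|beta| / (2 * C), s < (`|beta| / 2) ^+ 3 / C ^+ 4 &
      exists A B : R, [/\ 0 <= A <= C, 0 <= B, B ^+ 3 = s * A ^+ 4,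
        `|B - `|beta| | <= C * s & 1 <= C * (A + B)]].
    apply: (@filter_ex _ (0^'+ : set_system R)); near=> s; split; last by near: s.
    - by near: s; exact: nbhs_right_gt.
    - by near: s; apply: nbhs_right_lt; rewrite divr_gt0 // mulr_gt0.
    - by near: s; apply: nbhs_right_lt; rewrite divr_gt0 ?exprn_gt0 // divr_gt0.
  have hB : `|beta| / 2 <= B.
    move: s1; rewrite ltr_pdivlMr ?mulr_gt0 // => s1.
    move: hb; rewrite ler_norml => /andP[]; nra.
  have : (`|beta| / 2) ^+ 3 <= B ^+ 3 by rewrite lerXn2r ?nnegrE ?divr_ge0.
  rewrite e leNgt => /negP[].
  move: s2; rewrite ltr_pdivlMr ?exprn_gt0 //; apply: le_lt_trans.
  by rewrite ler_wpM2l ?(ltW s0) // lerXn2r ?nnegrE ?(ltW C0).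
rewrite b0 normr0 in hab.
(* Now [B <= C * s]. The bound [s < (2 * C ^+ 2)^-1] gives [A >= (2 * C)^-1], whereas
   [A ^+ 4 <= C ^+ 3 * s ^+ 2 <= C ^+ 3 * s] is below [(2 * C) ^- 4]. *)
have [s [s0 s1 s2 [A [B [/andP[A0 AC] B0 e hb hs]]]]] : exists s,
    [/\ 0 < s, s < 1, s < ((2 * C) ^- 4) / C ^+ 3 /\ s < (2 * C ^+ 2)^-1  &
    exists A B : R, [/\ 0 <= A <= C, 0 <= B, B ^+ 3 = s * A ^+ 4,
        `|B - 0| <= C * s & 1 <= C * (A + B)]].
  apply: (@filter_ex _ (0^'+ : set_system R)); near=> s; split; last by near: s.
  - by near: s; exact: nbhs_right_gt.
  - by near: s; exact: nbhs_right_lt.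
  - split; near: s; apply: nbhs_right_lt.
      by rewrite divr_gt0 ?exprn_gt0 // invr_gt0 exprn_gt0 // mulr_gt0.
    by rewrite invr_gt0 mulr_gt0 // exprn_gt0.
rewrite subr0 ger0_norm // in hb; case: s2 => s2 s3.
have hA : (2 * C)^-1 <= A.
  rewrite -(ler_pM2l C0) invfM mulrCA divff ?gt_eqF // mulr1.
  have : C ^+ 2 * s <= 2^-1.
    by move: s3; rewrite -div1r ltr_pdivlMr ?mulr_gt0 ?exprn_gt0 //; lra.
  have : C * B <= C ^+ 2 * s by rewrite expr2 -mulrA ler_wpM2l ?(ltW C0).
  move: hs; lra.
have : (2 * C) ^- 4 <= A ^+ 4.
  by rewrite -exprVn lerXn2r ?nnegrE // invr_ge0 mulr_ge0 ?(ltW C0).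
rewrite leNgt => /negP[].
move: s2; rewrite ltr_pdivlMr ?exprn_gt0 //; apply: le_lt_trans.
have : s * A ^+ 4 <= (C * s) ^+ 3 by rewrite -e lerXn2r ?nnegrE ?mulr_ge0 ?(ltW s0) ?(ltW C0).
rewrite exprMn [s ^+ 3]exprS [leRHS]mulrCA ler_pM2l // => /le_trans; apply.
rewrite mulrC ler_wpM2r ?exprn_ge0 ?(ltW C0) //.
by rewrite expr2 ler_piMr ?(ltW s0) ?(ltW s1).
Unshelve. all: by end_near. Qed.


(** * Singularity of the origin and absence of interior points *)

Lemma ler_norm_rV2 (x : 'rV[R]_2) : `|x| <= `|x 0 0| + `|x 0 1|.
Proof.
rewrite [leLHS]/Num.Def.normr /= mx_normrE bigmax_le ?addr_ge0 // => -[i j] _ /=.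
rewrite ord1; by have [->|/ord2_neq0->] := eqVneq j 0; rewrite ?lerDl ?lerDr.
Qed.

(** A straightening chart would make [s |-> psi (q + s *: e0)] an immersed parametrization of the
    curve. Lipschitz bounds for [psi] and [phi] and a second-order expansion of the second
    coordinate supply the hypotheses of [cusp_no_immersion]. *)
Lemma cusp_singular0 : ~ analytic_manifold_at 1 cusp 0.
Proof.
move=> [_ _ [U [V [phi [psi [[oU U0 oV] [[aphi apsi hphi hpsi] hstr]]]]]]].
pose q := phi 0; have [Vq psiq] : V q /\ psi q = 0 := hphi _ U0.
have q1 : q 0 1 = 0 := (hstr _ U0).1 cusp0 1 isT.
pose e0 : 'rV[R]_2 := delta_mx 0 0.
have [C0 hC0] := analytic_at_locally_lipschitz (apsi q Vq 0).
have [C1 hC1] := analytic_at_locally_lipschitz (apsi q Vq 1).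
have [beta [C2 hC2]] := analytic_at_line_taylor2 0 (apsi q Vq 1).
have [C3 hC3] := analytic_at_locally_lipschitz (aphi 0 U0 0).
have ne0 (s : R) : `|s *: e0| = `|s|.
  apply/eqP; rewrite eq_le; apply/andP; split.
    by rewrite (le_trans (ler_norm_rV2 _)) // !mxE /= mulr1 mulr0 normr0 addr0.
  by rewrite (le_trans _ (ler_coord_norm _ 0)) // !mxE /= mulr1.
have line (P : set 'rV[R]_2) : nbhs q P -> \forall s \near 0^'+, P (q + s *: e0).
  move=> /nbhs_ballP[e /= e_gt0 qP]; near=> s; apply: qP.
  rewrite -ball_normE /= opprD addNKr normrN ne0 gtr0_norm.
    by near: s; exact: nbhs_right_lt.
  by near: s; exact: nbhs_right_gt.
(* A single positive constant dominating the four local ones, whose signs are unknown. *)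
pose C := 1 + `|C0| + `|C1| + `|C2| + `|C3|.
have leC (D s : R) : 0 <= s -> D \in [:: C0; C1; C2; C3] -> D * s <= C * s.
  move=> s0 DC; rewrite ler_wpM2r // (le_trans (ler_norm _)) // /C.
  have := (normr_ge0 C0, normr_ge0 C1, normr_ge0 C2, normr_ge0 C3).
  by move: DC; rewrite !inE => /or4P[]/eqP-> [[[? ?] ?] ?]; lra.
have C_gt0 : 0 < C.
  have := (normr_ge0 C0, normr_ge0 C1, normr_ge0 C2, normr_ge0 C3).
  by rewrite /C => -[[[? ?] ?] ?]; lra.
have hpsiC j : \forall s \near 0^'+, `|psi (q + s *: e0) 0 j| <= C * s.
  have [-> |/ord2_neq0->] := eqVneq j 0; near=> s;
    have s0 : 0 < s by near: s; exact: nbhs_right_gt.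
  + have : `|psi (q + s *: e0) 0 0 - psi q 0 0| <= C0 * `|q + s *: e0 - q|.
      by near: s; exact: (line _ hC0).
    rewrite psiq mxE subr0 [q + _]addrC addrK ne0 (gtr0_norm s0).
    by move=> /le_trans; apply; rewrite leC ?(ltW s0) ?inE ?eqxx.
  + have : `|psi (q + s *: e0) 0 1 - psi q 0 1| <= C1 * `|q + s *: e0 - q|.
      by near: s; exact: (line _ hC1).
    rewrite psiq mxE subr0 [q + _]addrC addrK ne0 (gtr0_norm s0).
    by move=> /le_trans; apply; rewrite leC ?(ltW s0) ?inE ?eqxx ?orbT.
apply: (@cusp_no_immersion (fun s => psi (q + s *: e0) 0 0)
  (fun s => psi (q + s *: e0) 0 1) beta C C_gt0).
have [e /= e_gt0 he] := (nbhs_ballP _ _).1 hC3.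
near=> s.
have s0 : 0 < s by near: s; exact: nbhs_right_gt.
have Vs : V (q + s *: e0) by near: s; apply: line; exact: open_nbhs_nbhs.
have [Us phis] := hpsi _ Vs.
have small0 : `|psi (q + s *: e0) 0 0| <= C * s by near: s; exact: hpsiC.
have small1 : `|psi (q + s *: e0) 0 1| <= C * s by near: s; exact: hpsiC.
split => //.
- apply: (hstr _ Us).2 => i i1; by rewrite phis (ord2_gt0 i1) !mxE q1 mulr0 addr0.
- have : `|psi (q + s *: e0) 0 1 - psi q 0 1 - beta * s| <= C2 * s ^+ 2.
    by near: s; apply: (cvg_within (F := nbhs (0 : R))); exact: hC2.
  rewrite psiq mxE subr0 => /le_trans; apply.
  by rewrite leC ?exprn_ge0 ?(ltW s0) ?inE ?eqxx ?orbT.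
(* Once the curve point is in the ball where the bound for [phi] holds, that bound controls [s], the
   increment of the first coordinate of [phi]. *)
- have small : `|psi (q + s *: e0)| < e.
    apply: (le_lt_trans (ler_norm_rV2 _)).
    apply: (@le_lt_trans _ _ (2 * C * s)); first by lra.
    rewrite mulrC -ltr_pdivlMr ?mulr_gt0 //; near: s; apply: nbhs_right_lt.
    by rewrite divr_gt0 // mulr_gt0.
  have := he (psi (q + s *: e0)); rewrite -ball_normE /= sub0r normrN => /(_ small).
  rewrite phis subr0 -/q !mxE /= mulr1 [q 0 0 + _]addrC addrK (gtr0_norm s0).
  move=> /le_trans; apply; apply: le_trans (ler_wpM2l (ltW C_gt0) (ler_norm_rV2 _)).
  by apply: leC => //; rewrite !inE eqxx ?orbT.
Unshelve. all: by end_near. Qed.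

(** In dimension 2 the straightening imposes no equation, so the curve would contain a ball; but
    moving vertically from [p] changes [y ^+ 3] and keeps [x] fixed. *)
Lemma cusp_empty_interior p : ~ analytic_manifold_at 2 cusp p.
Proof.
move=> [Yp _ [U [V [phi [psi [[oU Up oV] [_ hstr]]]]]]].
have /nbhs_ballP[e /= e0 pU] := open_nbhs_nbhs (conj oU Up).
pose x := p + (e / 2) *: delta_mx 0 1.
have Ux : U x.
  apply: pU; rewrite -ball_normE /= opprD addNKr normrN.
  apply: (le_lt_trans (ler_norm_rV2 _)).
  by rewrite !mxE /= mulr0 mulr1 normr0 add0r gtr0_norm; lra.
have : cusp x.
  by apply: (hstr _ Ux).2 => i; rewrite leqNgt ltn_ord.
rewrite /cusp /= !mxE /= mulr0 mulr1 addr0 -Yp; set d := e / 2; set y := p 0 1.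
have d0 : 0 < d by rewrite divr_gt0.
(* This is [(y + d) ^+ 3 - y ^+ 3] with the square completed. *)
have : 0 < d * (3 * (y + d / 2) ^+ 2 + d ^+ 2 / 4).
  rewrite mulr_gt0 // ltr_wpDl //; first by rewrite mulr_ge0 ?sqr_ge0.
  by rewrite divr_gt0 // exprn_gt0.
have -> : d * (3 * (y + d / 2) ^+ 2 + d ^+ 2 / 4) = (y + d) ^+ 3 - y ^+ 3 by field.
by rewrite subr_gt0 => lt_y eq_y; move: lt_y; rewrite eq_y ltxx.
Qed.

End CuspCurve.

(** * Germs and Nash modifications of the line and of the cusp *)

Section LineAndCusp.
Variable R : realType.

Lemma cvg_pt2 (T : Type) (F : set_system T) {FF : Filter F} (f g : T -> R) a b :
  f @ F --> a -> g @ F --> b -> (fun t => pt2 (f t) (g t)) @ F --> pt2 a b.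
Proof.
have pt2E x y : pt2 x y = x *: delta_mx 0 0 + y *: delta_mx 0 1 :> 'rV[R]_2.
  by apply: eq_rV2; rewrite ?pt2E0 ?pt2E1 !mxE /= !(mulr1, mulr0) ?addr0 ?add0r.
move=> fa gb; rewrite pt2E; under eq_cvg do rewrite pt2E.
by apply: cvgD; exact: cvgZr_tmp.
Qed.

(** * Pure dimension of the curve *)

Lemma cusp_eq0 (p : 'rV[R]_2) : cusp p -> p 0 0 = 0 -> p = 0.
Proof.
rewrite /cusp /= => e p0; apply: eq_rV2; rewrite ?mxE //.
by apply/eqP; move: e; rewrite p0 expr0n => /eqP; rewrite expf_eq0.
Qed.

Lemma cvg_cusp_curve :
  (fun t : R => pt2 (t ^+ 3) (t ^+ 4)) @ (0 : R) --> (0 : 'rV[R]_2).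
Proof.
have -> : 0 = pt2 (0 ^+ 3) (0 ^+ 4) :> 'rV[R]_2.
  by apply: eq_rV2; rewrite ?pt2E0 ?pt2E1 mxE expr0n.
by apply: cvg_pt2; exact: exprn_continuous.
Qed.

Lemma cusp_curve_regular (t : R) : t != 0 ->
  analytic_manifold_at 1 (@cusp R) (pt2 (t ^+ 3) (t ^+ 4)).
Proof.
by move=> t0; apply: cusp_regular_neq0; [exact: cusp_pt2|rewrite pt2E0 expf_neq0].
Qed.

(** The origin is the only point with [x = 0], and it is the limit of the regular points
    [(t ^+ 3, t ^+ 4)]. Dimension 2 is excluded by the lack of interior. *)
Lemma pure_dim_cusp : pure_dim (@cusp R) 1.
Proof.
move=> p Yp; split=> [B pB|e /(_ setT filterT)[x [mx _]]]; last first.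
  have e2 : (e <= 2)%N by case: mx.
  have : e != 2%N by apply/eqP => ee; rewrite ee in mx; exact: cusp_empty_interior mx.
  by move: e2; rewrite [(e <= 2)%N]leq_eqVlt => /predU1P[->|//].
have [p0|p0] := eqVneq (p 0 0) 0; last first.
  by exists p; split; [exact: cusp_regular_neq0|exact: nbhs_singleton].
rewrite (cusp_eq0 Yp p0) in pB.
have /filter_ex[t [t0 Bt]] : \forall t \near (0 : R)^', t != 0 /\ B (pt2 (t ^+ 3) (t ^+ 4)).
  near=> t; split; first by near: t; exact: nbhs_dnbhs_neq.
  by near: t; apply: nbhs_dnbhs; exact: cvg_cusp_curve.
by exists (pt2 (t ^+ 3) (t ^+ 4)); split => //; exact: cusp_curve_regular.
Unshelve. all: by end_near. Qed.

(** * The line as a smooth analytic set *)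

Lemma analytic_at_coord1 (p : 'rV[R]_1) : analytic_at (fun x => x 0 0) p.
Proof.
have -> : (fun x : 'rV[R]_1 => x 0 0) = (fun x => \prod_(i < 1) x 0 i ^+ 1).
  by apply/funext => x; rewrite big_ord1.
by apply: (@analytic_at_prod R 1 (fun _ x => x ^+ 1)) => i; exact: analytic1_exp.
Qed.

Lemma line_regular (p : 'rV[R]_1) : analytic_manifold_at 1 [set: 'rV[R]_1] p.
Proof.
split=> //; exists setT, setT, id, id; split; first by split => //; exact: openT.
have id_an : analytic_map_on [set: 'rV[R]_1] id.
  by move=> q _ j; rewrite ord1; exact: analytic_at_coord1.
by split=> // x _; split=> // _ i; rewrite leqNgt ltn_ord.
Qed.

(** The whole space is the zero set of the map to a space of dimension 0. *)
Lemma analytic_subset_setT n : analytic_subset [set: 'rV[R]_n].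
Proof.
move=> p; exists setT, 0%N, (fun=> 0); split=> //; first exact: openT.
by move=> q _ [].
Qed.

Lemma pure_dim_line : pure_dim [set: 'rV[R]_1] 1.
Proof.
move=> p _; split=> [|e /(_ setT filterT)[x [[]//]]].
by apply: subset_closure; exact: line_regular.
Qed.

Lemma Sing_line : Sing 1 [set: 'rV[R]_1] = set0.
Proof. by apply/seteqP; split=> // p [_]; apply; exact: line_regular. Qed.

(** * Cube roots and the bi-Lipschitz germ *)

(** The real cube root; the sign is split off because the real power acts as a root only on
    nonnegative numbers. *)
Definition cbrt (y : R) : R := Num.sg y * `|y| `^ 3^-1.

Lemma cbrtK y : cbrt y ^+ 3 = y.
Proof.
rewrite /cbrt exprMn.
have -> : (`|y| `^ 3^-1) ^+ 3 = `|y|.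
  by rewrite -powR_mulrn ?powR_ge0 // -powRrM mulVf // powRr1.
have -> : Num.sg y ^+ 3 = Num.sg y.
  by case: sgrP => _; rewrite ?expr0n ?expr1n // -signr_odd expr1.
by rewrite -numEsg.
Qed.

(** The cofactor [x ^+ 2 + x * y + y ^+ 2] is positive when [x] and [y] differ. *)
Lemma cube_inj : injective (fun x : R => x ^+ 3).
Proof.
move=> x y /= e; apply/eqP; rewrite -subr_eq0; apply: contraT => xy.
have : (x - y) * (x ^+ 2 + x * y + y ^+ 2) = 0.
  by rewrite -[RHS](subrr (y ^+ 3)) -{1}e; ring.
move=> /eqP; rewrite mulf_eq0 (negbTE xy) /= => /eqP e2.
have : (x - y) ^+ 2 > 0 by rewrite exprn_even_gt0.
nra.
Qed.

Lemma cbrt_lt1 y : `|y| < 1 -> `|cbrt y| < 1.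
Proof. by rewrite -{1}(cbrtK y) normrX expr_lt1. Qed.

(** At cube roots this says that [x^(4/3)] is 4-Lipschitz on the open unit interval about 0. After
    factoring out [a - b], use [(a + b) ^+ 2 <= 4] and [a ^+ 2 + b ^+ 2 <= 2 * (a ^+ 2 + a * b + b
    ^+ 2)]. *)
Lemma fourth_power_lipschitz (a b : R) : `|a| < 1 -> `|b| < 1 ->
  (a ^+ 4 - b ^+ 4) ^+ 2 <= 16 * (a ^+ 3 - b ^+ 3) ^+ 2.
Proof.
move=> a1 b1.
have -> : a ^+ 4 - b ^+ 4 = (a - b) * ((a + b) * (a ^+ 2 + b ^+ 2)) by ring.
have -> : a ^+ 3 - b ^+ 3 = (a - b) * (a ^+ 2 + a * b + b ^+ 2) by ring.
rewrite !exprMn [leRHS]mulrCA ler_wpM2l ?sqr_ge0 //.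
have hab : (a + b) ^+ 2 <= 4.
  by move: a1 b1; rewrite !ltr_norml => /andP[? ?] /andP[? ?]; nra.
have hq : (a ^+ 2 + b ^+ 2) ^+ 2 <= 4 * (a ^+ 2 + a * b + b ^+ 2) ^+ 2.
  have -> : 4 = 2 ^+ 2 :> R by ring.
  have ? := sqr_ge0 (a + b); have ? := sqr_ge0 a; have ? := sqr_ge0 b.
  by rewrite -exprMn lerXn2r ?nnegrE //; nra.
apply: (le_trans (ler_pM _ _ hab hq)); rewrite ?sqr_ge0 //.
by rewrite mulrA -natrM.
Qed.

Lemma germs_bilipschitz_line_cusp : germs_bilipschitz [set: 'rV[R]_1] (@cusp R).
Proof.
have nU n (i : 'I_n) : nbhs (0 : 'rV[R]_n) [set x | `|x 0 i| < 1].
  have := @coord_continuous R 1 n 0 i 0; rewrite /continuous_at mxE.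
  by move=> /cvgr0_norm_lt; exact.
exists [set x | `|x 0 0| < 1], [set x | `|x 0 0| < 1],
  (fun x => pt2 (x 0 0) (cbrt (x 0 0) ^+ 4)); split.
- exact: nU.
- exact: nU.
- split.
  + move=> x [_ /= x1]; split; rewrite /= ?pt2E0 //.
    by rewrite /cusp /= pt2E0 pt2E1 -exprM mulnC exprM cbrtK.
  + move=> x y _ _ /rowP/(_ 0); rewrite !pt2E0 => e.
    by apply/rowP => j; rewrite ord1.
  + move=> y [Yy /= y1]; exists (const_mx (y 0 0)); first by rewrite /= mxE.
    apply: eq_rV2; rewrite ?pt2E0 ?pt2E1 mxE //; apply: cube_inj => /=.
    by rewrite Yy -exprM mulnC exprM cbrtK.
- apply: eq_rV2; rewrite ?pt2E0 ?pt2E1 !mxE //.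
  by rewrite /cbrt sgr0 mul0r expr0n.
(* The graph map expands squared distances by at most [1 + 16 <= 5 ^+ 2]; the projection back does
   not expand distances. *)
exists 5, 1 => x y [_ /= x1] [_ /= y1]; rewrite /euclid_dist.
rewrite big_ord1 !big_ord_recl big_ord0 addr0 (_ : lift 0 0 = 1 :> 'I_2); last exact/val_inj.
rewrite !pt2E0 !pt2E1 mul1r; split; last by rewrite ler_wsqrtr // lerDl sqr_ge0.
have -> : 5 = Num.sqrt (5 ^+ 2) :> R by rewrite sqrtr_sqr ger0_norm.
rewrite -sqrtrM ?sqr_ge0 // ler_wsqrtr //.
have := fourth_power_lipschitz (cbrt_lt1 x1) (cbrt_lt1 y1); rewrite !cbrtK.
have := sqr_ge0 (x 0 0 - y 0 0); nra.
Qed.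

(** * Tangent lines and the Nash modification of the curve *)

Lemma row_free_pt2 (t : R) : row_free (pt2 3 t).
Proof.
suff nz : pt2 3 t != 0 by rewrite /row_free rank_rV nz.
by apply/eqP => /rowP/(_ 0)/eqP; rewrite pt2E0 mxE pnatr_eq0.
Qed.

(** The velocity [(3 t^2, 4 t^3)] of the parametrization divided by [t^2], which stays nonzero at
    [t = 0]. *)
Definition cusp_direction (t : R) : full_rank_mx R 2 1 :=
  exist _ (pt2 3 (4 * t)) (mem_set (row_free_pt2 (4 * t))).

Lemma mem_cusp_plane t v :
  v \in (\val (plane_of (cusp_direction t)) : {vspace 'rV[R]_2}) <->
  exists c, v = c *: pt2 3 (4 * t).
Proof.
rewrite /= /row_span /image_mem enum_ordSl enum_ord0 /= row_id span_seq1.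
by split => [/vlineP//|]; move=> ?; apply/vlineP.
Qed.

(** The direction is continuous into full-rank matrices, and [plane_of] is continuous by definition
    of the quotient topology. *)
Lemma continuous_cusp_plane : continuous (fun t => plane_of (cusp_direction t)).
Proof.
have cd : continuous cusp_direction.
  apply: continuous_comp_initial => t /=.
  apply: cvg_pt2; first exact: cvg_cst.
  by apply: cvgMl_tmp.
apply/continuousP => W oW.
exact: ((continuousP _).1 cd (@plane_of R 2 1 @^-1` W) oW).
Qed.

Lemma tangent_cuspP (t : R) v : t != 0 ->
  tangent_vector (@cusp R) (pt2 (t ^+ 3) (t ^+ 4)) v <->
  exists c, v = c *: pt2 3 (4 * t).
Proof.
move=> t0; split.
  move=> [gamma [g0 dg hg]].
  have [_ dg0 _] := nbhs_singleton hg.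
  have hd (i : 'I_2) : derivable (fun s => gamma s 0 i) 0 1.
    by have /derivable_mxP := dg0; exact.
  have vE i : v 0 i = 'D_1 (fun s => gamma s 0 i) 0.
    by rewrite -dg derive1E derive_mx // mxE.
  (* Differentiate the equation of the curve along [gamma]; it holds near 0, which suffices for the
     derivatives there. The result is [3 t^8 v_1 = 4 t^9 v_0]. *)
  have : 'D_1 ((fun s => gamma s 0 1) ^+ 3) 0 = 'D_1 ((fun s => gamma s 0 0) ^+ 4) 0.
    apply: near_eq_derive; apply: filterS hg => s [Ys _ _].
    by rewrite !exprfctE.
  rewrite !deriveX // -!vE g0 pt2E0 pt2E1 /GRing.scale /= => e.
  exists (v 0 0 / 3); apply: eq_rV2; rewrite !mxE /=; first by field.
  have t8 : 3 * t ^+ 8 != 0 by rewrite mulf_neq0 ?expf_neq0 ?pnatr_eq0.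
  apply: (mulfI t8).
  have -> : 3 * t ^+ 8 * v 0 1 = 3 * (t ^+ 4) ^+ 2 * v 0 1 by ring.
  by rewrite e; field.
(* Conversely, run through the parametrization at speed [d]: the velocity [d * (3 t^2, 4 t^3)]
   equals [c * (3, 4 t)]. *)
move=> [c ->]; pose d := c / t ^+ 2.
pose lin (s : R) := t + d * s.
have dlin (s : R) k : is_derive s (1 : R) (fun s => lin s ^+ k.+1) (k.+1%:R * d * lin s ^+ k).
  have hl : is_derive s (1 : R) lin d.
    apply: is_derive_eq; rewrite /GRing.scale /=; ring.
  have := is_deriveX k.+1 hl; rewrite (_ : lin ^+ k.+1 = fun s => lin s ^+ k.+1).
    by move=> /is_derive_eq; apply; rewrite /GRing.scale /=; ring.
  by apply/funext => u; rewrite exprfctE.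
have clin k : continuous (fun s => lin s ^+ k).
  move=> s; apply: (@continuous_comp _ _ _ lin (fun r : R => r ^+ k)).
    by apply: cvgD; [exact: cvg_cst|apply: cvgMl_tmp].
  exact: exprn_continuous.
exists (fun s => pt2 (lin s ^+ 3) (lin s ^+ 4)).
have dm s : derivable (fun s => pt2 (lin s ^+ 3) (lin s ^+ 4)) s 1.
  apply/derivable_mxP => i j; rewrite ord1.
  have [->|/ord2_neq0->] := eqVneq j 0.
    by under eq_fun do rewrite pt2E0; have [] := dlin s 2%N.
  by under eq_fun do rewrite pt2E1; have [] := dlin s 3%N.
have dE : derive1 (fun s => pt2 (lin s ^+ 3) (lin s ^+ 4)) =
    (fun s => pt2 (3 * d * lin s ^+ 2) (4 * d * lin s ^+ 3)).
  apply/funext => s; rewrite derive1E derive_mx //.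
  apply: eq_rV2; rewrite mxE ?pt2E0 ?pt2E1.
    by under eq_fun do rewrite pt2E0; have [] := dlin s 2%N.
  by under eq_fun do rewrite pt2E1; have [] := dlin s 3%N.
split.
- by rewrite /lin mulr0 addr0.
- rewrite dE /lin mulr0 addr0 /d.
  by apply: eq_rV2; rewrite [RHS]mxE ?pt2E0 ?pt2E1; field.
- near=> s; split => //; first exact: cusp_pt2.
  by rewrite dE; apply: cvg_pt2; apply: cvgMl_tmp; exact: clin.
Unshelve. all: by end_near. Qed.

Lemma cusp_nu_graph (t : R) : t != 0 ->
  nu_graph 1 (@cusp R) (pt2 (t ^+ 3) (t ^+ 4), plane_of (cusp_direction t)).
Proof.
move=> t0; split; first exact: cusp_curve_regular.
move=> v; apply: iff_trans (mem_cusp_plane t v) _.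
by apply: iff_sym; exact: tangent_cuspP.
Qed.

(** The lifted curve of points and tangent lines extends continuously to [t = 0] and lies in the
    graph for [t != 0], so its value at 0 is in the closure. *)
Lemma nash_cusp0 : nash 1 (@cusp R) (0, plane_of (cusp_direction 0)).
Proof.
split; last exact: cusp0.
have cz : (fun t => (pt2 (t ^+ 3) (t ^+ 4), plane_of (cusp_direction t))) @ (0 : R)
    --> ((0 : 'rV[R]_2), plane_of (cusp_direction 0)).
  have cc : _ --> _ := cvg_cusp_curve.
  exact: (cvg_pair cc (@continuous_cusp_plane 0)).
move=> B nB.
have /filter_ex[t [t0 Bt]] : \forall t \near (0 : R)^', t != 0 /\
    B (pt2 (t ^+ 3) (t ^+ 4), plane_of (cusp_direction t)).
  near=> t; split; first by near: t; exact: nbhs_dnbhs_neq.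
  by near: t; apply: nbhs_dnbhs; exact: (cz _ nB).
exists (pt2 (t ^+ 3) (t ^+ 4), plane_of (cusp_direction t)); split => //.
exact: cusp_nu_graph.
Unshelve. all: by end_near. Qed.

Lemma Sing_cusp0 : Sing 1 (@cusp R) 0.
Proof. by split; [exact: cusp0|exact: cusp_singular0]. Qed.

End LineAndCusp.

Theorem proposition1p9 (R : realType) :
  exists (n m r s : nat) (X : set 'rV[R]_n) (Y : set 'rV[R]_m),
    [/\ analytic_subset X, pure_dim X r & X 0] /\
    [/\ analytic_subset Y, pure_dim Y s & Y 0] /\
    germs_bilipschitz X Y /\
    ~ exists f : ('rV[R]_n * grassmannian R n r)%type ->
                 ('rV[R]_m * grassmannian R m s)%type,
        set_homeomorphism (nash r X) (nash s Y) f /\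
        f @` nash_preimage r X (Sing r X) = nash_preimage s Y (Sing s Y).
Proof.
exists 1%N, 2%N, 1%N, 1%N, setT, (@cusp R); split; [split=> //|split; [split|split]].
- exact: analytic_subset_setT.
- exact: pure_dim_line.
- exact: analytic_subset_cusp.
- exact: pure_dim_cusp.
- exact: cusp0.
- exact: germs_bilipschitz_line_cusp.
move=> [f [_ fE]].
(* This point over the origin would have to be the image of a point over the empty singular locus of
   the line. *)
have : nash_preimage 1 (@cusp R) (Sing 1 (@cusp R))
    (0, plane_of (cusp_direction (0 : R))).
  by split; [exact: nash_cusp0|exact: Sing_cusp0].
by rewrite -fE => -[z [_]]; rewrite /= Sing_line.
Qed.
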